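(* Let $IF_{2m}=\sum_{\iota\in F\mathcal{I}_{2m}(321)} q^{\mathrm{inv}(\iota)}$. Then $IF_0=1$ and for $m>0$, $$IF_{2m}=\sum_{k=1}^m q^{2k-1}\, IF_{2k-2}\, IF_{2(m-k)}.$$
   Context: A permutation $\sigma$ of $[n]$ (one-line notation) contains a pattern $\pi\in\mathfrak{S}_k$ if some subsequence $\sigma(m_1)\cdots\sigma(m_k)$ with $m_1<\dots<m_k$ is in the same relative order as $\pi$; otherwise it avoids $\pi$. An involution is a permutation with $\iota^2=\mathrm{id}$; it is fixed-point-free if $\iota(i)\ne i$ for all $i$. $F\mathcal{I}_n(\pi)$ is the set of fixed-point-free involutions of $[n]$ avoiding $\pi$ ($F\mathcal{I}_0$ contains the empty permutation). $\mathrm{inv}(\sigma)$ is the number of pairs $i<j$ with $\sigma(i)>\sigma(j)$. *)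

(* Defs.v *)
From mathcomp Require Import all_boot all_order all_fingroup all_algebra.

Set Implicit Arguments.
Unset Strict Implicit.
Unset Printing Implicit Defensive.

Import GRing.Theory.

(* Permutations of [n] are elements of 'S_n, with positions and values
   numbered from 0; the empty permutation is the only element of 'S_0. *)

(* [f] lists the positions m_1 < ... < m_k of the occurrence of [p] in [s]. *)
Definition contains (n k : nat) (s : 'S_n) (p : 'S_k) : bool :=
  [exists f : {ffun 'I_k -> 'I_n},
     [forall i : 'I_k, forall j : 'I_k, (i < j) ==> (f i < f j)]
     && [forall i : 'I_k, forall j : 'I_k,
           (s (f i) < s (f j)) == (p i < p j)]].

Definition avoids (n k : nat) (s : 'S_n) (p : 'S_k) : bool :=
  ~~ contains s p.

Definition involution (n : nat) (s : 'S_n) : bool := (s ^+ 2 == 1)%g.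

Definition fixed_point_free (n : nat) (s : 'S_n) : bool :=
  [forall i : 'I_n, s i != i].

Definition FI (n k : nat) (p : 'S_k) : {set 'S_n} :=
  [set s : 'S_n | [&& involution s, fixed_point_free s & avoids s p]].

Definition inv (n : nat) (s : 'S_n) : nat :=
  #|[set ij : 'I_n * 'I_n | (ij.1 < ij.2) && (s ij.2 < s ij.1)]|.

Definition p321 : 'S_3 := perm (@rev_ord_inj 3).

Definition IF (n : nat) : {poly int} :=
  (\sum_(s in FI n p321) 'X ^+ inv s)%R.

(* Main.v *)
Require Import Defs.
From mathcomp Require Import all_boot all_order all_fingroup all_algebra.
From mathcomp Require Import zify.

(** A fixed-point-free involution is a perfect matching, and it avoids 321 iff
    no two arcs are nested, so arcs are closed in the order in which they were
    opened.  Let [IFo (n + h) h] be the generating polynomial of the matchings of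
    [n + h] points whose first [h] points all open arcs.  Point [h] either opens
    an arc, or closes the arc of point [0]; in the latter case that arc crosses
    the [h - 1] other open ones, and deleting it removes [2 (h - 1) + 1]
    inversions.  Hence it is [dyck n h], the weighted count of the length-[n] Dyck path
    suffixes starting at height [h], in which a down step from height [h] weighs [q^(2h-1)], and
    the theorem is the first-return decomposition of these paths. *)

Set Implicit Arguments.
Unset Strict Implicit.
Unset Printing Implicit Defensive.

Import GRing.Theory.

Local Open Scope nat_scope.

(** * Non-nesting involutions *)

(** If [i] closes an arc, then [s i < i < j < s j] anyway, so the condition bears on arcs opened at
    [i] and [j]. *)
Definition nonnesting n (s : 'S_n) : Prop :=
  forall i j : 'I_n, i < j -> j < s j -> s i < s j.

Lemma contains321P n (s : 'S_n) :
  reflect (exists i j k : 'I_n, [/\ i < j, j < k, s k < s j & s j < s i])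
          (contains s p321).
Proof.
apply: (iffP existsP) => [[f /andP[/forallP fmono /forallP fpat]]|].
  have mono (a b : 'I_3) : a < b -> f a < f b.
    by move=> ab; move/forallP/(_ b)/implyP: (fmono a); apply.
  have pat (a b : 'I_3) : b < a -> s (f a) < s (f b).
    move=> ba; move/forallP/(_ b)/eqP: (fpat a) => ->.
    rewrite !permE /=; have := ltn_ord a; lia.
  exists (f 0%R), (f 1%R), (f 2%R).
  by split; [apply: mono | apply: mono | apply: pat | apply: pat].
move=> [i [j [k [ij jk skj sji]]]].
exists [ffun a : 'I_3 => tnth [tuple i; j; k] a].
by apply/andP; split; apply/forallP => -[[|[|[|a]]] Ha] //;
   apply/forallP => -[[|[|[|b]]] Hb] //; rewrite !ffunE !(tnth_nth i) ?permE /=;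
   lia.
Qed.

(** Nested arcs [i < j < s j < s i] give a 321 at [i], [j], [s j]. Conversely, in a 321 at [i], [j],
    [k], either [j] opens an arc nested in that of [i], or it closes one nested in that of [k]. *)
Lemma FI321P n (s : 'S_n) :
  reflect [/\ involutive s, forall i, s i != i & nonnesting s]
          (s \in FI n p321).
Proof.
rewrite inE; apply: (iffP and3P) => [[/eqP s2 /forallP fpf av]|[sK fpf nn]].
  have sK : involutive s by move=> x; rewrite -permM -[(s * s)%g]/(s ^+ 2)%g s2 perm1.
  split=> // i j ij jsj; rewrite ltnNge; apply/negP => sji.
  case/negP: av; apply/contains321P; exists i, j, (s j); rewrite sK; split=> //.
  rewrite ltn_neqAle sji andbT; apply: contraTneq ij.
  by move=> /val_inj/perm_inj ->; rewrite ltnn.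
split; first by apply/eqP/permP => x; rewrite expgS expg1 permM sK perm1.
  exact/forallP.
apply/contains321P => -[i [j [k [ij jk skj sji]]]].
have [jsj|] := ltnP j (s j); first by have := nn _ _ ij jsj; lia.
rewrite leq_eqVlt => /orP[/eqP/val_inj/eqP|sjj]; first by rewrite (negbTE (fpf j)).
by have := nn _ _ skj; rewrite !sK => /(_ sjj); lia.
Qed.

(** * Deleting the arc of the first point *)

Section InsertArc.
Variables (N : nat) (h : 'I_N.+1).

Definition other (k : 'I_N) : 'I_N.+2 := lift ord0 (lift h k).
Definition closer : 'I_N.+2 := lift ord0 h.

Definition insert_arc (t : 'S_N) : 'S_N.+2 :=
  lift_perm ord0 closer (lift_perm h ord0 t).

Lemma otherE k : other k = (if k < h then k.+1 else k.+2) :> nat.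
Proof. by rewrite /other !lift0 /= /bump; case: leqP. Qed.

Lemma closerE : closer = h.+1 :> nat.
Proof. by rewrite lift0. Qed.

Lemma point_cases (P : 'I_N.+2 -> Prop) :
  P ord0 -> P closer -> (forall k, P (other k)) -> forall x, P x.
Proof.
move=> P0 Ph Pk x; case: (unliftP ord0 x) => [y|] -> //.
by case: (unliftP h y) => [k|] ->; [apply: Pk | apply: Ph].
Qed.

Lemma other_inj : injective other.
Proof. by move=> k l /lift_inj/lift_inj. Qed.

Lemma ltn_other k l : (other k < other l) = (k < l).
Proof. by rewrite !otherE; do 2 case: ifP; lia. Qed.

Lemma other_lt_closer k : (other k < closer) = (k < h).
Proof. by rewrite otherE closerE; case: ifP; lia. Qed.

Lemma closer_lt_other k : (closer < other k) = (h <= k).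
Proof. by rewrite otherE closerE; case: ifP; lia. Qed.

Lemma insert_arc0 t : insert_arc t ord0 = closer.
Proof. exact: lift_perm_id. Qed.

Lemma insert_arc_closer t : insert_arc t closer = ord0.
Proof.
rewrite /insert_arc lift_perm_lift lift_perm_id; apply: val_inj.
by rewrite /= /bump.
Qed.

Lemma insert_arc_other t k : insert_arc t (other k) = other (t k).
Proof.
(* Skipping [closer] and 0 among the values gives the same enumeration in either order. *)
rewrite /insert_arc !lift_perm_lift; apply: val_inj.
by rewrite /= /bump; lia.
Qed.

Definition insert_arcE := (insert_arc0, insert_arc_closer, insert_arc_other).

Lemma insert_arc_inj : injective insert_arc.
Proof.
move=> t u tu; apply/permP => k; apply: other_inj.
by rewrite -!insert_arc_other tu.
Qed.

Lemma insert_arc_surj (s : 'S_N.+2) :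
  s ord0 = closer -> s closer = ord0 -> exists t, s = insert_arc t.
Proof.
move=> s0 sh.
have sk k : exists l, s (other k) == other l.
  have: s (other k) != ord0 by rewrite -sh (inj_eq perm_inj) (inj_eq lift_inj) eq_sym neq_lift.
  have: s (other k) != closer by rewrite -s0 (inj_eq perm_inj) eq_sym neq_lift.
  elim/point_cases: (s (other k)) => [||l _ _]; rewrite ?eqxx //.
  by exists l.
pose f k := xchoose (sk k).
have fE k : s (other k) = other (f k) by apply/eqP/(xchooseP (sk k)).
have f_inj : injective f.
  by move=> k l /(congr1 other); rewrite -!fE => /perm_inj/other_inj.
exists (perm f_inj); apply/permP; apply: point_cases; rewrite ?insert_arcE //.
by move=> k; rewrite insert_arcE permE.
Qed.

Lemma big_points (F : 'I_N.+2 -> nat) :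
  \sum_x F x = F ord0 + F closer + \sum_k F (other k).
Proof. by rewrite (bigD1_ord ord0) // (bigD1_ord h) //= addnA. Qed.

End InsertArc.

Lemma invE n (s : 'S_n) :
  Defs.inv s = \sum_(i < n) \sum_(j < n) ((i < j) && (s j < s i) : nat).
Proof.
rewrite /Defs.inv -sum1dep_card pair_bigA /= big_mkcond /=.
by apply: eq_bigr => -[i j] _ /=; case: ifP.
Qed.

Lemma sum_ltn_ord N m : m <= N -> \sum_(k < N) (k < m : nat) = m.
Proof.
move=> mN; transitivity (\sum_(k < m) 1).
  by rewrite (big_ord_widen N (fun=> 1) mN) [RHS]big_mkcond; apply: eq_bigr => k _; case: ifP.
by rewrite big_const_ord iter_addn_0 mul1n.
Qed.

(** Point 0 is inverted with [closer] and with the [h] others whose values lie below [closer];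
    [closer], of value 0, is also inverted with the [h] others before it. *)
Lemma inv_insert_arc N (h : 'I_N.+1) (t : 'S_N) :
  Defs.inv (insert_arc h t) = Defs.inv t + (2 * h + 1).
Proof.
have hN : h <= N by rewrite -ltnS.
have row0 : \sum_(j < N.+2) ((0 < j) && (insert_arc h t j < insert_arc h t ord0) : nat)
            = h.+1.
  rewrite (big_points h) !insert_arcE closerE /= add0n add1n; congr _.+1.
  rewrite -[RHS](sum_ltn_ord hN) [RHS](reindex_perm t) /=.
  by apply: eq_bigr => k _; rewrite insert_arcE -closerE other_lt_closer.
have row_closer :
    \sum_(j < N.+2) ((closer h < j) && (insert_arc h t j < insert_arc h t (closer h)) : nat)
    = 0.
  by rewrite big1 // => j _; rewrite insert_arcE ltn0 andbF.
have row_other k :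
    \sum_(j < N.+2) ((other h k < j) && (insert_arc h t j < insert_arc h t (other h k)) : nat)
    = (k < h) + \sum_(l < N) ((k < l) && (t l < t k) : nat).
  rewrite (big_points h) !insert_arcE ltn0 add0n other_lt_closer.
  congr (_ + _); first by rewrite otherE; case: (k < h) => //; case: ifP.
  by apply: eq_bigr => l _; rewrite insert_arcE !ltn_other.
rewrite !invE (big_points h) row0 row_closer (eq_bigr _ (fun k _ => row_other k)).
rewrite big_split /= sum_ltn_ord //; lia.
Qed.

(** * Matchings starting with [h] openers *)

(** On a fixed-point-free involution this says that the first [h] points are openers: an arc with
    both ends below [h] would have a closer there. *)
Definition opens n h (s : 'S_n) : bool :=
  [forall i : 'I_n, (i < h) ==> (h <= s i)].

Lemma opensP n h (s : 'S_n) :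
  reflect (forall i : 'I_n, i < h -> h <= s i) (opens h s).
Proof.
by apply: (iffP forallP) => H i; [apply/implyP | apply/implyP/H].
Qed.

Lemma opens0 n (s : 'S_n) : opens 0 s.
Proof. exact/opensP. Qed.

Lemma opens_all n (s : 'S_n.+1) : ~~ opens n.+1 s.
Proof. by apply/opensP => /(_ ord0 isT); rewrite leqNgt ltn_ord. Qed.

Lemma opensS_opens n h (s : 'S_n) : opens h.+1 s -> opens h s.
Proof. by move=> /opensP H; apply/opensP => i ih; have := H i; lia. Qed.

Lemma opens1_FI n (s : 'S_n.+1) : s \in FI n.+1 p321 -> opens 1 s.
Proof.
move=> /FI321P[_ fpf _]; apply/opensP => i i0; rewrite lt0n.
apply: contra (fpf i) => /eqP si; apply/eqP/val_inj => /=; lia.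
Qed.

(* Nonnesting forces the first arc to be closed to be that of point 0. *)
Lemma first_closer N (h : 'I_N.+1) (s : 'S_N.+2) :
  s \in FI N.+2 p321 -> opens h.+1 s -> ~~ opens h.+2 s -> s ord0 = closer h.
Proof.
move=> /FI321P[sK fpf nn] /opensP op /forallPn[i].
rewrite negb_imply -ltnNge => /andP[ih sih].
have cE := closerE h.
(* Point [h.+1] is the first closer; its partner [j] is [i] or [s i], according to which end of the
   arc [i] is. *)
have [j [jh sj]] : exists j : 'I_N.+2, j < h.+1 /\ s j = closer h.
  have [ih'|hi] := ltnP i h.+1.
    by exists i; split=> //; apply: ord_inj; have := op i ih'; lia.
  have ic : i = closer h by apply: ord_inj; lia.
  exists (s i); rewrite sK; split=> //.
  have : (s i : nat) != i by apply: contra (fpf i) => /eqP/val_inj/eqP.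
  lia.
have [j0|j0] := posnP j; first by rewrite -sj; congr (s _); apply: val_inj.
have := nn ord0 j j0; rewrite sj => /(_ ltac:(lia)).
have := op ord0 isT; lia.
Qed.

(** The new arc must enclose no other: an arc of [t] opened at [k] closes at or after [h], by
    [opens h t] if [k < h], and since [k < t k] otherwise. *)
Lemma insert_arc_FI N (h : 'I_N.+1) (t : 'S_N) : opens h t ->
  (insert_arc h t \in FI N.+2 p321) = (t \in FI N p321).
Proof.
move=> /opensP op.
apply/FI321P/FI321P => -[sK fpf nn]; split.
- by move=> k; apply: (@other_inj _ h); rewrite -!insert_arc_other sK.
- by move=> k; have := fpf (other h k); rewrite insert_arcE (inj_eq (@other_inj _ h)).
- by move=> i j; have := nn (other h i) (other h j); rewrite !insert_arcE !ltn_other.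
- by apply: (point_cases (h := h)) => [||k]; rewrite !insert_arcE ?sK.
- apply: (point_cases (h := h)) => [||k]; rewrite ?insert_arcE //.
  by rewrite (inj_eq (@other_inj _ h)).
- move=> i j; move: j i.
  apply: (point_cases (h := h)) => [||k] //; first by rewrite insert_arcE.
  apply: (point_cases (h := h)) => [||i]; rewrite !insert_arcE ?ltn_other.
  + rewrite closer_lt_other => _ ktk; have [kh|] := ltnP k h; first exact: op.
    lia.
  + by rewrite otherE; case: ifP.
  + exact: nn.
Qed.

Lemma opens_insert_arc N (h : 'I_N.+1) (t : 'S_N) :
  opens h.+1 (insert_arc h t) = opens h t.
Proof.
apply/opensP/opensP => op.
  move=> k kh; have := op (other h k).
  by rewrite insert_arcE -(closerE h) other_lt_closer (leqNgt (closer h)) other_lt_closer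
     -leqNgt; apply.
apply: (point_cases (h := h)) => [||k]; rewrite insert_arcE ?(closerE h) ?ltnn //.
rewrite -(closerE h) other_lt_closer (leqNgt (closer h)) other_lt_closer -leqNgt.
exact: op.
Qed.

Lemma opensS_insert_arc N (h : 'I_N.+1) (t : 'S_N) :
  ~~ opens h.+2 (insert_arc h t).
Proof.
by apply/opensP => /(_ ord0 isT); rewrite insert_arcE closerE ltnn.
Qed.

Local Open Scope ring_scope.

Definition IFo (n h : nat) : {poly int} :=
  \sum_(s in FI n p321 | opens h s) 'X ^+ Defs.inv s.

Lemma IFo0 n : IFo n 0 = IF n.
Proof. by apply: eq_bigl => s; rewrite opens0 andbT. Qed.

Lemma IFo_split n h :
  IFo n h = IFo n h.+1
    + \sum_(s in FI n p321 | opens h s && ~~ opens h.+1 s) 'X ^+ Defs.inv s.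
Proof.
rewrite /IFo (bigID (opens h.+1)) /=; congr (_ + _); apply: eq_bigl => s.
  by rewrite -andbA; case op: (opens h.+1 s); rewrite ?andbF // (opensS_opens op).
by rewrite andbA.
Qed.

(** [insert_arc h] maps the matchings counted by [IFo N h] bijectively onto these. *)
Lemma IFo_closer N (h : 'I_N.+1) :
  \sum_(s in FI N.+2 p321 | opens h.+1 s && ~~ opens h.+2 s) 'X ^+ Defs.inv s
  = 'X ^+ (2 * h + 1) * IFo N h.
Proof.
rewrite /IFo big_distrr /=.
under [RHS]eq_bigr do rewrite -exprD addnC -inv_insert_arc.
rewrite -[RHS](big_imset (fun s => 'X ^+ Defs.inv s) (in2W (@insert_arc_inj N h))) /=.
apply: eq_bigl => s; apply/and3P/imsetP => [[sFI op nop]|[t]].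
  have s0 := first_closer sFI op nop.
  have sc : s (closer h) = ord0 by rewrite -s0; case/FI321P: sFI.
  have [t st] := insert_arc_surj s0 sc; subst s; exists t => //.
  by rewrite opens_insert_arc in op; rewrite unfold_in -(insert_arc_FI op) sFI.
case/andP=> tFI op ->; split; last exact: opensS_insert_arc.
  by rewrite insert_arc_FI.
by rewrite opens_insert_arc.
Qed.

(** * First-return decomposition *)

Fixpoint dyck (n h : nat) : {poly int} :=
  match n, h with
  | 0, 0 => 1
  | 0, _.+1 => 0
  | n.+1, 0 => dyck n 1
  | n.+1, h.+1 => dyck n h.+2 + 'X ^+ (2 * h + 1) * dyck n h
  end.

Lemma IF_0 : IF 0 = 1.
Proof.
have s1 (s : 'S_0) : s = 1%g by apply/permP => -[].
rewrite /IF (big_pred1 1%g) => [|s].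
  by rewrite invE big_ord0.
by rewrite (s1 s) /= eqxx; apply/FI321P; split=> -[].
Qed.

Lemma IFo_dyck n h : IFo (n + h) h = dyck n h.
Proof.
elim: n h => [|n IH] [|h] /=.
- by rewrite IFo0 IF_0.
- by apply: big_pred0 => s; rewrite (negbTE (opens_all s)) andbF.
(* Point 0 always opens an arc, so the sum over closers is empty. *)
- rewrite -IH IFo_split addn0 addn1 big1 ?addr0 // => s /and3P[sFI _].
  by rewrite opens1_FI.
- rewrite -!IH IFo_split !addnS !addSn.
  have hN : (h < (n + h).+1)%N by rewrite ltnS leq_addl.
  by rewrite (IFo_closer (Ordinal hN)) addn0 addn1.
Qed.

Lemma dyck_odd n h : odd (n + h) -> dyck n h = 0.
Proof.
elim: n h => [|n IH] [|h] //= par; first by rewrite IH // addn1 -[n]addn0.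
by rewrite !IH ?mulr0 ?addr0 //; move: par; rewrite !addnS /= ?negbK.
Qed.

(* The path is cut at its first visit to the height just below its start; the
   piece above that height has [(j + h) / 2] down steps, each one level up. *)
Lemma dyck_first_passage n h :
  dyck n h.+1 =
    \sum_(j < n) 'X ^+ (j + h + 1) * dyck j h * dyck (n - j.+1) 0.
Proof.
elim: n h => [|n IH] h; first by rewrite big_ord0.
(* Term [j] collects the paths first reaching height 0 at step [j + 1]: lowering their first [j]
   steps by one level takes [q^2] from each of [(j + h) / 2] down steps, and the step from 1 to 0
   weighs [q]. Term 0 vanishes unless [h = 0]. *)
rewrite big_ord_recl /= subn1 /= IH; case: h => [|h] /=.
  rewrite addrC mulr1; congr (_ + _); apply: eq_bigr => j _.
  by rewrite /bump /= !subSS; congr ('X ^+ _ * _ * _); lia.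
rewrite mulr0 mul0r add0r IH big_distrr -big_split /=.
apply: eq_bigr => j _; rewrite /bump /= !subSS mulrDr mulrDl.
congr (_ + _); first by congr ('X ^+ _ * _ * _); lia.
rewrite !mulrA -!exprD; congr ('X ^+ _ * _ * _); lia.
Qed.

Lemma big_ord_even (V : nmodType) (m : nat) (F : nat -> V) :
  (forall j, odd j -> F j = 0) ->
  \sum_(j < (2 * m).+1) F j = \sum_(k < m.+1) F (2 * k)%N.
Proof.
move=> F0; elim: m => [|m IH]; first by rewrite !big_ord1.
rewrite mulnS addSn addSn add0n big_ord_recr big_ord_recr /= IH.
rewrite (F0 (2 * m).+1) ?addr0 /= ?oddM // [RHS]big_ord_recr /=.
by rewrite mulnS.
Qed.

Local Close Scope ring_scope.

Theorem theorem3p14 :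
  (IF 0 = 1)%R /\
  (forall m : nat, 0 < m ->
    IF (2 * m) =
      (\sum_(1 <= k < m.+1)
         'X ^+ (2 * k - 1) * IF (2 * k - 2) * IF (2 * (m - k)))%R).
Proof.
split; first exact: IF_0.
have IFE n : IF n = dyck n 0 by rewrite -IFo_dyck addn0 IFo0.
case=> // m _; rewrite IFE mulnS add2n -[LHS]/(dyck (2 * m).+1 1).
rewrite dyck_first_passage.
pose F j := ('X ^+ (j + 0 + 1) * dyck j 0 * dyck ((2 * m).+1 - j.+1) 0)%R.
(* Only even [j] contribute; [j = 2 * k - 2] for the index [k] of the theorem. *)
rewrite -[LHS]/(\sum_(j < (2 * m).+1) F j)%R big_ord_even => [|j oj]; last first.
  by rewrite /F (@dyck_odd j) ?addn0 // mulr0 mul0r.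
rewrite big_add1 /= big_mkord; apply: eq_bigr => k _; rewrite /F !IFE.
by congr ('X ^+ _ * dyck _ _ * dyck _ _)%R; lia.
Qed.
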